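(* Let $N\in\mathbb{Z}_{>0}$, let the cell parameters $R_{d,i},C_{d,i},R_{\text{int},i},Q_i\in\mathbb{R}_{>0}$ ($i\in\{1,\dots,N\}$) be constants, let $\tau_{d,i}:=R_{d,i}C_{d,i}$, and let $V_{OCV}:\mathbb{R}\to\mathbb{R}$ be continuously differentiable with $0<a_1:=\min_{z\in\mathbb{R}}V_{OCV}'(z)\le\max_{z\in\mathbb{R}}V_{OCV}'(z)=:a_2<\infty$. Let $\tau_d>0$, $\mu\in(0,1]$, and let $\ell>0$ and $\varepsilon>0$ be arbitrary. Consider the hybrid system $\mathcal{H}$ defined in the context with these data. Then for any càdlàg input $u:\mathbb{R}_{\ge0}\to\mathbb{R}$, any corresponding solution $q$ to $\mathcal{H}$ satisfies, for all $(t,j)\in\operatorname{dom} q$, $$|\widehat{SOC}(t,j)-SOC_{\min}(t,j)|\le\Big(\tfrac{\sqrt N}{a_1}+c_1\Big)|e(0,0)|e^{-bt}+\Big(\tfrac{1}{a_1}+c_3\Big)\varepsilon+\Big(\tfrac{\sqrt N\,\tau_d}{a_1}+c_4\Big)d\,\|U_{RC}\|_{(t,j)},$$ where $SOC_{\min}:=\min_{i\in\{1,\dots,N\}}SOC_i$, $e:=(SOC_\sigma-\widehat{SOC},\,U_{RC,1}-\widehat U_{RC,1},\dots,U_{RC,N}-\widehat U_{RC,N})$, $d:=\max_{i\in\{1,\dots,N\}}\big|\tfrac{1}{\tau_d}-\tfrac{1}{\tau_{d,i}}\big|$, $a:=\min\{\ell a_1,\tfrac1{\tau_d}\}$, $c_1:=\sqrt{\max\{1,\tfrac{4}{a_1^2}\}}$,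 $c_2:=\tfrac a2$, $c_3:=\tfrac4{a_1}$, $c_4:=\tfrac{2}{a_1}\sqrt{\tfrac{\tau_d}{a}}$ and $b:=\min\{\tfrac1{2\tau_d},c_2\}$.
   Context: Battery model. For each cell $i\in\{1,\dots,N\}$ the state is $x_i=(U_{RC,i},SOC_i)\in\mathbb{R}^2$; $x=(x_1,\dots,x_N)\in\mathbb{R}^{2N}$, $U_{RC}=(U_{RC,1},\dots,U_{RC,N})$. All cells share the same input $u$ (the pack current). Dynamics: $\dot U_{RC,i}=-\frac1{\tau_{d,i}}U_{RC,i}+\frac1{C_{d,i}}u$, $\dot{SOC}_i=-\frac1{3600Q_i}u$; output (cell voltage) $y_i=-U_{RC,i}-R_{\text{int},i}u+V_{OCV}(SOC_i)$. Hybrid system $\mathcal{H}$. The state is $q=(x,\overline U_{RC},\widehat{SOC},\sigma)\in\mathcal{Q}:=\mathbb{R}^{2N}\times\mathbb{R}\times\mathbb{R}\times\{1,\dots,N\}$. Define for every $i$: $\widehat U_{RC,i}:=\frac1{C_{d,i}}\overline U_{RC}$, $\widehat U_{RC}:=(\widehat U_{RC,1},\dots,\widehat U_{RC,N})$, and $z_i:=y_i+\widehat U_{RC,i}+R_{\text{int},i}u$, which equals $V_{OCV}(SOC_i)-U_{RC,i}+\widehat U_{RC,i}$ (so it depends on $q$ only). Flow: while $q\in\mathcal{C}$, $x$ follows the dynamics above and $\dot{\overline U}_{RC}=-\frac1{\tau_d}\overline U_{RC}+u$, $\dot{\widehat{SOC}}=-\frac1{3600Q_\sigma}u+\ell(y_\sigma-\hat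 y)$, $\dot\sigma=0$, with $\hat y:=-\widehat U_{RC,\sigma}-R_{\text{int},\sigma}u+V_{OCV}(\widehat{SOC})$. Jump: when $q\in\mathcal{D}$, $x^+=x$, $\overline U_{RC}^+=\overline U_{RC}$, $\widehat{SOC}^+=V_{OCV}^{-1}\big(\min_{i\in\{1,\dots,N\}\setminus\{\sigma\}}z_i\big)$, $\sigma^+\in\arg\min_{i\in\{1,\dots,N\}\setminus\{\sigma\}}z_i$ (set-valued jump map $G$; $V_{OCV}$ is bijective on $\mathbb{R}$ under the assumptions). Sets: $\mathcal{C}:=\{q\in\mathcal{Q}:\forall i\in\{1,\dots,N\}\setminus\{\sigma\},\ V_{OCV}(\widehat{SOC})-\varepsilon\le z_i\}$, $\mathcal{D}:=\{q\in\mathcal{Q}:\forall i\in\{1,\dots,N\}\setminus\{\sigma\},\ V_{OCV}(\widehat{SOC})-\varepsilon\le z_i,\ \text{and}\ \exists i\in\{1,\dots,N\}\setminus\{\sigma\}\text{ with } z_i\le V_{OCV}(\widehat{SOC})-\mu\varepsilon\}$. Solutions. A hybrid time domain is a subset of $\mathbb{R}_{\ge0}\times\mathbb{Z}_{\ge0}$ that is a finite or infinite union of intervals $[t_j,t_{j+1}]\times\{j\}$ with $0=t_0\le t_1\le\cdots$, the last one (if any) possibly of the form $[t_j,T)\times\{j\}$ with $T\le\infty$. A hybrid arc is a function on a hybrid time domain that is locally absolutely continuous in $t$ for each fixed $j$. A solution to $\mathcal{H}$ for a càdlàg (right-continuous with left limits) input $u$ is a hybrid arc $q$ such that $q(0,0)\in\mathcal{C}\cup\mathcal{D}$;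 for each $j$ such that $I^j:=\{t:(t,j)\in\operatorname{dom}q\}$ has nonempty interior, $q(t,j)\in\mathcal{C}$ for all $t$ in the interior of $I^j$ and the flow equations hold with input $u(t)$ for almost all $t\in I^j$; and whenever $(t,j),(t,j+1)\in\operatorname{dom}q$, $q(t,j)\in\mathcal{D}$ and $q(t,j+1)\in G(q(t,j))$. Notation. $|\cdot|$ is the Euclidean norm. $(t',j')\le(t,j)$ means $t'\le t$ and $j'\le j$. For a hybrid arc $w$, with $\Gamma(w)$ the set of $(t',j')\in\operatorname{dom}w$ such that $(t',j'+1)\in\operatorname{dom}w$, $\|w\|_{(t,j)}:=\max\{\operatorname{ess\,sup}_{(t',j')\in\operatorname{dom}w\setminus\Gamma(w),\,(0,0)\le(t',j')\le(t,j)}|w(t',j')|,\ \sup_{(t',j')\in\Gamma(w),\,(0,0)\le(t',j')\le(t,j)}|w(t',j')|\}$. Quantities such as $SOC_\sigma$, $SOC_{\min}$, $e$, $U_{RC}$ evaluated at $(t,j)$ are computed from $q(t,j)$. *)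

(* Defs.v *)
From HB Require Import structures.
From mathcomp Require Import all_boot all_order all_algebra.
From mathcomp Require Import all_classical all_reals all_analysis.
From mathcomp Require Import ess_sup_inf ring.

Set Implicit Arguments.
Unset Strict Implicit.
Unset Printing Implicit Defensive.

Import Order.TTheory GRing.Theory Num.Theory numFieldNormedType.Exports.

Local Open Scope classical_set_scope.
Local Open Scope ring_scope.

Section Preliminaries.
Context {R : realType}.
Implicit Types (E : set (R * nat)).

Definition is_minimum (A : set R) (m : R) : Prop := A m /\ lbound A m.
Definition is_maximum (A : set R) (m : R) : Prop := A m /\ ubound A m.

(* The norm `|v| of a matrix in the library is the maximum norm. *)
Definition enorm (n : nat) (v : 'rV[R]_n) : R :=
  Num.sqrt (\sum_(i < n) v 0 i ^+ 2).

(* Inputs are defined on [0, +oo[: values at negative times are irrelevant. *)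
Definition cadlag (u : R -> R) : Prop :=
  (forall t, 0 <= t -> u s @[s --> t^'+] --> u t) /\
  (forall t, 0 < t -> cvg (u s @[s --> t^'-])).

(* The intervals are pairwise non-overlapping; l k = r k is harmless. *)
Definition abs_continuous (a b : R) (f : R -> R) : Prop :=
  forall e : R, 0 < e -> exists2 d : R, 0 < d &
    forall (n : nat) (l r : 'I_n -> R),
      (forall k, a <= l k /\ l k <= r k /\ r k <= b) ->
      trivIset [set: 'I_n] (fun k => `]l k, r k[%classic) ->
      \sum_(k < n) (r k - l k) < d ->
      \sum_(k < n) `|f (r k) - f (l k)| < e.

Definition loc_abs_continuous (I : set R) (f : R -> R) : Prop :=
  forall a b : R, a <= b -> `[a, b]%classic `<=` I -> abs_continuous a b f.

(* First disjunct: infinitely many compact intervals [t_j, t_(j+1)]; second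
   one: J + 1 intervals, the last of which is compact or right-open.  In the
   finite case the values of t beyond those in use are irrelevant. *)
Definition hybrid_time_domain E : Prop :=
  exists t : nat -> R,
    [/\ t 0%N = 0, forall j, t j <= t j.+1 &
      E = [set p | t p.2 <= p.1 <= t p.2.+1] \/
      exists J : nat, exists2 I : set R,
        I = `[t J, t J.+1]%classic \/
        (exists2 T : \bar R, ((t J)%:E < T)%E &
           I = [set s | t J <= s /\ (s%:E < T)%E]) &
        E = [set p | (p.2 < J)%N /\ t p.2 <= p.1 <= t p.2.+1] `|`
            [set p | p.2 = J /\ I p.1]].

Definition slice E (j : nat) : set R := [set t | E (t, j)].

Definition jump_times E : set (R * nat) :=
  [set p | E p /\ E (p.1, p.2.+1)].

Definition upto (t : R) (j : nat) : set (R * nat) :=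
  [set p | 0 <= p.1 <= t /\ (p.2 <= j)%N].

(* The norm ||w||_(t, j) of w on the domain E.  The essential supremum is
   taken with respect to Lebesgue measure on each slice, then over the slices;
   multiplying by an indicator function only adds the value 0, so that both
   suprema are over nonnegative quantities and an essential supremum over a
   null set is 0. *)
Definition hnorm E (n : nat) (w : R -> nat -> 'rV[R]_n) (t : R) (j : nat)
    : \bar R :=
  maxe
    (ereal_sup (range (fun k : nat =>
       ess_sup lebesgue_measure (fun s : R =>
         (\1_(slice ((E `\` jump_times E) `&` upto t j) k) s
            * enorm (w s k))%:E))))
    (ereal_sup [set (enorm (w p.1 p.2))%:E
               | p in jump_times E `&` upto t j]).

End Preliminaries.

Record params (R : realType) (N : nat) := Params {
  R_d : 'I_N -> R;
  C_d : 'I_N -> R;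
  R_int : 'I_N -> R;
  Q_c : 'I_N -> R;
  V_ocv : R -> R;
  tau_d : R;
  mu_j : R;
  ell : R;
  eps : R
}.

Record state (R : realType) (N : nat) := State {
  Urc : 'rV[R]_N;
  soc : 'rV[R]_N;
  Ubar : R;
  soch : R;
  sigma : 'I_N
}.

Section Battery.
Context {R : realType} {N : nat}.
Variable p : params R N.
Implicit Types (q : state R N) (v : R) (i : 'I_N).

Definition tau_di i : R := R_d p i * C_d p i.

Definition youtput q v i : R :=
  - Urc q 0 i - R_int p i * v + V_ocv p (soc q 0 i).

Definition Uhat q : 'rV[R]_N := \row_i ((C_d p i)^-1 * Ubar q).

Definition yhat q v : R :=
  - Uhat q 0 (sigma q) - R_int p (sigma q) * v + V_ocv p (soch q).

Definition zcell q i : R := V_ocv p (soc q 0 i) - Urc q 0 i + Uhat q 0 i.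

Lemma zcellE q v i : zcell q i = youtput q v i + Uhat q 0 i + R_int p i * v.
Proof. by rewrite /zcell /youtput; ring. Qed.

Definition Cset : set (state R N) :=
  [set q | forall i, i != sigma q -> V_ocv p (soch q) - eps p <= zcell q i].

Definition Dset : set (state R N) :=
  [set q | (forall i, i != sigma q -> V_ocv p (soch q) - eps p <= zcell q i) /\
           exists2 i, i != sigma q &
             zcell q i <= V_ocv p (soch q) - mu_j p * eps p].

Definition argmin (A : set 'I_N) (f : 'I_N -> R) : set 'I_N :=
  [set i | A i /\ forall k, A k -> f i <= f k].

Definition V_ocv_inv : R -> R := 'pinv_(fun=> 0) [set: R] (V_ocv p).

(* The default value zcell q (sigma q') of the iterated minimum is one of its
   terms, since sigma q' is distinct from sigma q. *)
Definition Gmap q : set (state R N) :=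
  [set q' | [/\ Urc q' = Urc q, soc q' = soc q, Ubar q' = Ubar q,
      soch q' = V_ocv_inv
        (\big[Num.min/zcell q (sigma q')]_(i < N | i != sigma q) zcell q i) &
      argmin [set i | i != sigma q] (zcell q) (sigma q')]].

Definition flow_at (q : R -> state R N) (u : R -> R) (t : R) : Prop :=
  [/\ forall i, is_derive t 1 (fun s => Urc (q s) 0 i)
        (- (tau_di i)^-1 * Urc (q t) 0 i + (C_d p i)^-1 * u t),
      forall i, is_derive t 1 (fun s => soc (q s) 0 i)
        (- (3600 * Q_c p i)^-1 * u t),
      is_derive t 1 (fun s => Ubar (q s))
        (- (tau_d p)^-1 * Ubar (q t) + u t),
      is_derive t 1 (fun s => soch (q s))
        (- (3600 * Q_c p (sigma (q t)))^-1 * u t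
         + ell p * (youtput (q t) (u t) (sigma (q t)) - yhat (q t) (u t))) &
      is_derive t 1 (fun s => (sigma (q s) : nat)%:R : R) 0].

(* A hybrid arc is a domain E with a function q, whose values outside E are
   irrelevant. *)
Definition hybrid_arc (E : set (R * nat)) (q : R -> nat -> state R N) : Prop :=
  hybrid_time_domain E /\
  forall j,
    [/\ forall i, loc_abs_continuous (slice E j) (fun t => Urc (q t j) 0 i),
        forall i, loc_abs_continuous (slice E j) (fun t => soc (q t j) 0 i),
        loc_abs_continuous (slice E j) (fun t => Ubar (q t j)),
        loc_abs_continuous (slice E j) (fun t => soch (q t j)) &
        loc_abs_continuous (slice E j) (fun t => (sigma (q t j) : nat)%:R)].

Definition solution (u : R -> R) (E : set (R * nat))
    (q : R -> nat -> state R N) : Prop :=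
  [/\ hybrid_arc E q,
      (Cset `|` Dset) (q 0 0%N),
      forall j, (slice E j)° !=set0 ->
        (forall t, (slice E j)° t -> Cset (q t j)) /\
        {ae lebesgue_measure, forall t, slice E j t ->
           flow_at (fun s => q s j) u t} &
      forall t j, E (t, j) -> E (t, j.+1) ->
        Dset (q t j) /\ Gmap (q t j) (q t j.+1)].

(* The default value is one of the terms. *)
Definition socmin q : R :=
  \big[Num.min/soc q 0 (sigma q)]_(i < N) soc q 0 i.

Definition err q : 'rV[R]_(1 + N) :=
  row_mx (\row_(_ < 1) (soc q 0 (sigma q) - soch q)) (Urc q - Uhat q).

(* The terms are nonnegative, so that the default value 0 is harmless. *)
Definition dmax : R :=
  \big[Num.max/0]_(i < N) `|(tau_d p)^-1 - (tau_di i)^-1|.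

End Battery.

(* Main.v *)
(* Let eta_i = U_RC,i - Uhat_RC,i and s = SOC_sigma - SOChat.  Along flows
   eta_i' = - eta_i / tau_d + (1 / tau_d - 1 / tau_d,i) U_RC,i, hence
   (|eta|^2)' <= - |eta|^2 / tau_d + tau_d d^2 |U_RC|^2, and
   s' = - ell (V(SOC_sigma) - V(SOChat)) + ell eta_sigma.  A comparison argument
   bounds |eta|^2 by H = |e(0)|^2 e^(-t/tau_d) + (tau_d D)^2, with D an essential
   bound of d |U_RC|, and then s^2 by
   B = max(1, 4/a1^2) |e(0)|^2 e^(-a t) + (4/a1^2) (tau_d/a) D^2 >= (4/a1^2) H.
   Jumps leave eta unchanged and reset V(SOChat) to
   V(SOC_sigma) - eta_sigma for the new sigma, so that
   s^2 <= |eta|^2 / a1^2 <= B still holds after a jump.  Finally the inequalities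
   defining C give SOChat - SOC_i <= (|eta_i| + eps) / a1 for i <> sigma; a point
   reached by a jump need not be in C, but jumps decrease SOChat and the point
   before the jump is in D, hence in C. *)
Require Import Defs.
From HB Require Import structures.
From mathcomp Require Import all_boot all_order all_algebra.
From mathcomp Require Import all_classical all_reals all_analysis.
From mathcomp Require Import ess_sup_inf ring lra.

Set Implicit Arguments.
Unset Strict Implicit.
Unset Printing Implicit Defensive.

Import Order.TTheory GRing.Theory Num.Theory numFieldNormedType.Exports.

Local Open Scope classical_set_scope.
Local Open Scope ring_scope.

(** * Absolutely continuous functions whose derivative is nonpositive almost everywhere *)

Lemma lebesgue_ae_imply (R : realType) (P Q : R -> Prop) :
  (forall x, P x -> Q x) -> {ae lebesgue_measure, forall x, P x} ->
  {ae lebesgue_measure, forall x, Q x}.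
Proof. exact: (@filterS _ _ (ae_filter_ringOfSetsType lebesgue_measure)). Qed.

Lemma trivIset_itvoo_sorted (R : realType) (n : nat) (l r : nat -> R) :
  (forall i j, (i < j < n)%N -> r i <= l j) ->
  trivIset [set: 'I_n] (fun k : 'I_n => `]l k, r k[%classic).
Proof.
move=> lr i j _ _ [x []] /=; rewrite !in_itv/= => /andP[lix xri] /andP[ljx xrj].
apply/val_inj; case: (ltngtP i j) => // ij; exfalso.
- have := lr i j; rewrite ij ltn_ord => /(_ isT) rl.
  by have := lt_trans xri (le_lt_trans rl ljx); rewrite ltxx.
- have := lr j i; rewrite ij ltn_ord => /(_ isT) rl.
  by have := lt_trans xrj (le_lt_trans rl lix); rewrite ltxx.
Qed.

(** Sorted closed intervals may share endpoints; their interiors are disjoint with the same lengths,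
    so additivity of the measure applies to those. *)
Lemma sum_length_le_measure (R : realType) (O : set R) (n : nat)
    (l r : nat -> R) :
  measurable O ->
  (forall k, (k < n)%N -> l k <= r k /\ `[l k, r k] `<=` O) ->
  (forall i j, (i < j < n)%N -> r i <= l j) ->
  ((\sum_(k < n) (r k - l k))%:E <= lebesgue_measure O)%E.
Proof.
move=> mO lrO lr.
have E (k : 'I_n) : (r k - l k)%:E = lebesgue_measure (`]l k, r k[ : set R).
  rewrite lebesgue_measure_itv/= lte_fin; case: ltP => // rl.
  have [lk _] := lrO k (ltn_ord k).
  by have -> : r k = l k by [apply/eqP; rewrite eq_le rl lk]; rewrite subrr.
rewrite -sumEFin (eq_bigr _ (fun k _ => E k)).
rewrite -(@measure_bigsetU_ord _ _ _ _ n xpredT)//; last first.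
  exact: trivIset_itvoo_sorted.
apply: le_measure; rewrite ?inE//; first exact: bigsetU_measurable.
rewrite -(bigcup_mkord n (fun k => `]l k, r k[%classic)) => x [k /= kn].
rewrite in_itv/= => /andP[/ltW lx /ltW xr].
by have [_ ] := lrO k kn; apply => /=; rewrite in_itv/= lx.
Qed.

(* Continuous induction on [x] shows that [f x - f a] is at most [e (x - a)]
   plus the variation of [f] on finitely many intervals contained in an open
   set of small measure which covers the exceptional null set. *)
Lemma abs_continuous_ae_nonincreasing (R : realType) (a b : R) (f : R -> R) :
  a <= b -> abs_continuous a b f ->
  {ae lebesgue_measure, forall x, a <= x <= b ->
     exists2 df, is_derive x 1 f df & df <= 0} ->
  f b <= f a.
Proof.
move=> ab ACf [Z [mZ Z0 subZ]].
apply/ler_addgt0Pr => e e0.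
(* Half of [e] pays for a slope [e1] along [[a, b]], half for the variation near the null set [Z];
   the [+ 1] keeps the denominator positive when [a = b]. *)
pose e1 := e / (2 * (b - a + 1)).
have ba1 : 0 < 2 * (b - a + 1) by nra.
have e10 : 0 < e1 by rewrite divr_gt0.
have e20 : 0 < e / 2 by rewrite divr_gt0.
have [d d0 Hd] := ACf _ e20.
have [|O [oO ZO muO]] := @lebesgue_regularity_outer R Z d mZ _ d0.
  by rewrite [X in (X < _)%E]Z0.
have mO : measurable O by apply: measurable_realfun.open_measurable.
(* Outer regularity bounds the measure of [O] minus [Z]; as [Z] is null, the bound holds for [O]. *)
have {}muO : (lebesgue_measure O < d%:E)%E.
  rewrite -(setDUK ZO); apply: le_lt_trans muO.
  rewrite measureU //; first last.
  - by rewrite setDE setICA setICr setI0.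
  - exact: measurableD.
  - by rewrite [X in (X + _)%E]Z0 add0e.
(* Differentiability at [x] only controls increments taken across [x], whence [y <= x <= z]. *)
have local x : a <= x <= b -> exists2 del, 0 < del &
    forall y z, x - del < y -> y <= x -> x <= z -> z < x + del ->
      f z - f y <= e1 * (z - y) \/ `[y, z] `<=` O.
  move=> axb; have [Zx|nZx] := pselect (Z x).
    have /nbhs_ballP[del /= del0 xO] := oO _ (ZO _ Zx).
    exists del => // y z xy yx xz zx; right => w /=.
    rewrite in_itv/= => /andP[yw wz].
    by apply: xO; rewrite /ball/= ltr_norml; lra.
  have [df dfx df0] : exists2 df : R, is_derive x 1 f df & df <= 0.
    by apply: contrapT => H; apply/nZx/subZ => /(_ axb).
  have [h [fE hc hx]] := (is_derive1_caratheodory f x df).1 dfx.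
  have /nbhs_ballP[del /= del0 he] : nbhs x (h @^-1` [set w | w < e1]).
    apply: (hc [set w | w < e1]); apply: lt_nbhsl.
    by rewrite hx; exact: le_lt_trans e10.
  exists del => // y z xy yx xz zx; left.
  have hz : h z < e1 by apply: he; rewrite /ball/= ltr_norml; lra.
  have hy : h y < e1 by apply: he; rewrite /ball/= ltr_norml; lra.
  have := fE z; have := fE y; nra.
(* The intervals spent on [Z] stay explicit and sorted, so that absolute continuity can be applied
   once to all of them at the end. *)
pose P x := exists n (l r : nat -> R), [/\
  forall k, (k < n)%N ->
    [/\ a <= l k, l k <= r k, r k <= x & `[l k, r k] `<=` O],
  forall i j, (i < j < n)%N -> r i <= l j &
  f x - f a <= e1 * (x - a) + \sum_(k < n) `|f (r k) - f (l k)|].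
have Pa : P a.
  exists 0%N, (fun=> 0), (fun=> 0); split => //.
  by rewrite ?big_ord0 ?subrr ?mulr0 ?addr0.
have Pstep y z : a <= y -> y <= z -> P y ->
    f z - f y <= e1 * (z - y) \/ `[y, z] `<=` O -> P z.
  move=> ay yz [n [l [r [lr ord fy]]]] [fzy|yzO].
    exists n, l, r; split => //; last by lra.
    by move=> k /lr[? ? ? ?]; split=> //; exact: le_trans yz.
  exists n.+1, (fun k => if (k < n)%N then l k else y),
    (fun k => if (k < n)%N then r k else z); split.
  - move=> k; rewrite ltnS leq_eqVlt => /orP[/eqP ->|kn]; first by rewrite ltnn.
    by rewrite kn; have [? ? ? ?] := lr _ kn; split=> //; exact: le_trans yz.
  - move=> i j /andP[ij]; rewrite ltnS leq_eqVlt => /orP[/eqP jn|jn].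
      by rewrite jn -{1}jn ij ltnn; have [] := lr i; rewrite -?jn.
    by rewrite jn (ltn_trans ij jn); apply: ord; rewrite ij.
  - rewrite big_ord_recr/= ltnn.
    rewrite (eq_bigr (fun k : 'I_n => `|f (r k) - f (l k)|)); last first.
      by move=> k _; rewrite ltn_ord.
    have := ler_norm (f z - f y); nra.
pose S := [set x | a <= x <= b /\ P x].
have Sa : S a by split => //; rewrite lexx.
have hS : has_sup S by split; [exists a|exists b => x [/andP[]]].
pose c := sup S.
have ac : a <= c by apply: ub_le_sup; [case: hS|].
have cb : c <= b by apply: ge_sup => [|x [/andP[]]]; [exists a|].
have [|del del0 Hdel] := local c; first by rewrite ac.
have [y [/andP[ay yb] Py] cy] : exists2 y, S y & c - del < y by exact: sup_adherent.
have yc : y <= c by apply: ub_le_sup; [case: hS|split=> //; rewrite ay].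
(* [z] exceeds the supremum [c] unless [b] stops it; since [z] is again in [S], this forces
   [z = b]. *)
pose z := Num.min b (c + del / 2).
have cz : c <= z by rewrite le_min cb; lra.
have zb : z <= b by rewrite ge_min lexx.
have Pz : P z.
  apply: (Pstep y) => //; first exact: le_trans cz.
  by apply: Hdel => //; rewrite gt_min; apply/orP; right; lra.
have zc : z <= c.
  by apply: ub_le_sup; [case: hS|split=> //; rewrite zb (le_trans ac cz)].
have zE : z = b.
  move: zc; rewrite /z; case: (leP b (c + del / 2)) => // _; lra.
move: Pz; rewrite zE => -[n [l [r [lr ord fb]]]].
suff : \sum_(k < n) `|f (r k) - f (l k)| < e / 2.
  have : e1 * (b - a) <= e / 2.
    rewrite /e1 -mulrA ler_pM2l// ler_pdivrMl//; lra.
  lra.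
apply: (Hd n (fun k => l k) (fun k => r k)).
- by move=> k; have [] := lr _ (ltn_ord k).
- exact: trivIset_itvoo_sorted.
- rewrite -lte_fin; apply: le_lt_trans muO.
  by apply: sum_length_le_measure => // k /lr[].
Qed.

(** * Closure properties of absolute continuity *)

(** Domination by the increments of two functions is the common source of the rules for sums,
    opposites, products and Lipschitz images. *)
Lemma abs_continuous_le (R : realType) (a b K : R) (f1 f2 g : R -> R) :
  abs_continuous a b f1 -> abs_continuous a b f2 ->
  (forall x y, a <= x -> x <= y -> y <= b ->
     `|g y - g x| <= K * (`|f1 y - f1 x| + `|f2 y - f2 x|)) ->
  abs_continuous a b g.
Proof.
move=> AC1 AC2 gK e e0.
pose e' := e / (2 * (`|K| + 1)).
have e'0 : 0 < e' by rewrite divr_gt0// mulr_gt0// ltr_wpDl.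
have [d1 d10 H1] := AC1 _ e'0; have [d2 d20 H2] := AC2 _ e'0.
exists (Num.min d1 d2); first by rewrite lt_min d10.
move=> n l r lr triv; rewrite lt_min => /andP[s1 s2].
have {s1 H1} := H1 n l r lr triv s1; have {s2 H2} := H2 n l r lr triv s2.
set S2 := \sum_(_ < _) _; set S1 := \sum_(_ < _) _ => S2e S1e.
have S10 : 0 <= S1 by apply: sumr_ge0.
have S20 : 0 <= S2 by apply: sumr_ge0.
have : \sum_(k < n) `|g (r k) - g (l k)| <= `|K| * (S1 + S2).
  rewrite /S1 /S2 -big_split/= mulr_sumr; apply: ler_sum => k _.
  have [al [lrk rb]] := lr k.
  by apply: le_trans (gK _ _ al lrk rb) _; rewrite ler_wpM2r ?addr_ge0// ler_norm.
move=> /le_lt_trans; apply.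
have ee : e' * (2 * (`|K| + 1)) = e by rewrite divfK// gt_eqF// mulr_gt0// ltr_wpDl.
have := normr_ge0 K; nra.
Qed.

Lemma abs_continuous_id (R : realType) (a b : R) : abs_continuous a b (@idfun R).
Proof.
move=> e e0; exists e => // n l r lr _ rle.
rewrite (eq_bigr (fun k => r k - l k))//= => k _.
by rewrite ger0_norm// subr_ge0; have [_ []] := lr k.
Qed.

Lemma abs_continuous_cst (R : realType) (a b c : R) :
  abs_continuous a b (fun=> c).
Proof.
apply: (@abs_continuous_le _ _ _ 1); try exact: abs_continuous_id.
by move=> *; rewrite subrr normr0 mul1r addr_ge0.
Qed.

Lemma abs_continuous_comp_lipschitz (R : realType) (a b K : R) (g f : R -> R) :
  abs_continuous a b f ->
  (forall x y, a <= x <= b -> a <= y <= b ->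
     `|g (f y) - g (f x)| <= K * `|f y - f x|) ->
  abs_continuous a b (g \o f).
Proof.
move=> ACf gK.
apply: (@abs_continuous_le _ _ _ K) ACf (@abs_continuous_cst _ _ _ 0) _.
move=> x y ax xy yb; rewrite subrr normr0 addr0; apply: gK.
  by rewrite ax (le_trans xy).
by rewrite yb (le_trans ax).
Qed.

Lemma abs_continuousD (R : realType) (a b : R) (f g : R -> R) :
  abs_continuous a b f -> abs_continuous a b g ->
  abs_continuous a b (fun x => f x + g x).
Proof.
move=> ACf ACg; apply: (@abs_continuous_le _ _ _ 1) ACf ACg _ => x y _ _ _.
by rewrite mul1r opprD addrACA ler_normD.
Qed.

Lemma abs_continuousN (R : realType) (a b : R) (f : R -> R) :
  abs_continuous a b f -> abs_continuous a b (fun x => - f x).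
Proof.
move=> ACf; apply: (abs_continuous_le (K := 1) ACf ACf) => x y _ _ _.
by rewrite mul1r -opprD normrN lerDl.
Qed.

Lemma abs_continuousB (R : realType) (a b : R) (f g : R -> R) :
  abs_continuous a b f -> abs_continuous a b g ->
  abs_continuous a b (fun x => f x - g x).
Proof. by move=> ACf ACg; apply: abs_continuousD ACf (abs_continuousN ACg). Qed.

Lemma abs_continuous_uniform (R : realType) (a b : R) (f : R -> R) :
  abs_continuous a b f -> forall e, 0 < e -> exists2 d, 0 < d &
    forall x y, a <= x -> x <= y -> y <= b -> y - x < d -> `|f y - f x| < e.
Proof.
move=> ACf e e0; have [d d0 H] := ACf e e0; exists d => // x y ax xy yb xyd.
have := H 1%N (fun=> x) (fun=> y); rewrite !big_ord1; apply => //.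
by move=> i j _ _ _; rewrite (ord1 i) (ord1 j).
Qed.

Lemma abs_continuous_bounded (R : realType) (a b : R) (f : R -> R) :
  abs_continuous a b f -> exists M, forall x, a <= x <= b -> `|f x| <= M.
Proof.
move=> /abs_continuous_uniform /(_ 1 ltr01)[d d0 H].
(* Steps of length [d / 2] stay within the modulus [d] and change [f] by less than 1, so [n] of them
   change it by at most [n]. *)
have bound n x : a <= x <= b -> x - a < n%:R * (d / 2) -> `|f x| <= `|f a| + n%:R.
  elim: n x => [x|n IHn x] /andP[ax xb]; first by rewrite mul0r; lra.
  rewrite -natr1 => xn; have [xa|xa] := leP (x - a) (d / 2).
    have := H a x; rewrite lexx => /(_ isT ax xb).
    have := ler_normD (f a) (f x - f a); rewrite addrC subrK addrC.
    have := ler0n R n; lra.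
  have := IHn (x - d / 2); have := H (x - d / 2) x.
  have := ler_normD (f (x - d / 2)) (f x - f (x - d / 2)).
  rewrite (addrC (f _)) subrK => H1 H2 H3.
  have {}H2 : `|f x - f (x - d / 2)| < 1 by apply: H2 => //; lra.
  have {}H3 : `|f (x - d / 2)| <= `|f a| + n%:R by apply: H3; lra.
  lra.
exists (`|f a| + (Num.truncn ((b - a) / (d / 2))).+1%:R) => x axb; apply: bound => //.
rewrite -ltr_pdivrMr; last lra.
apply: le_lt_trans (truncnS_gt _); rewrite ler_pM2r; last by rewrite invr_gt0; lra.
lra.
Qed.

Lemma abs_continuousM (R : realType) (a b : R) (f g : R -> R) :
  abs_continuous a b f -> abs_continuous a b g ->
  abs_continuous a b (fun x => f x * g x).
Proof.
move=> ACf ACg.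
have [M HM] := abs_continuous_bounded ACf.
have [M' HM'] := abs_continuous_bounded ACg.
apply: (@abs_continuous_le _ _ _ (Num.max M M')) ACf ACg _ => x y ax xy yb.
have -> : f y * g y - f x * g x = g x * (f y - f x) + f y * (g y - g x) by ring.
apply: le_trans (ler_normD _ _) _; rewrite !normrM mulrDr lerD//.
  by rewrite ler_wpM2r// le_max HM' ?orbT// ax (le_trans xy).
by rewrite ler_wpM2r// le_max HM// yb (le_trans ax).
Qed.

Lemma abs_continuous_sum (R : realType) (a b : R) (n : nat)
    (f : 'I_n -> R -> R) :
  (forall i, abs_continuous a b (f i)) ->
  abs_continuous a b (fun x => \sum_(i < n) f i x).
Proof.
elim: n f => [|n IHn] f ACf.
  under [X in abs_continuous _ _ X]funext do rewrite big_ord0.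
  exact: abs_continuous_cst.
under [X in abs_continuous _ _ X]funext do rewrite big_ord_recr/=.
exact: abs_continuousD (IHn (fun i => f (widen_ord (leqnSn n) i)) _) _.
Qed.

(** [expR] is Lipschitz with constant [expR M] on arguments at most [M], by [1 + s <= expR s], and
    [c * x] is bounded on [[a, b]]. *)
Lemma abs_continuous_expR (R : realType) (a b c : R) :
  abs_continuous a b (fun x => expR (c * x)).
Proof.
have ACc : abs_continuous a b (fun x => c * x).
  exact: abs_continuousM (abs_continuous_cst _ _ _) (@abs_continuous_id _ _ _).
have [M HM] := abs_continuous_bounded ACc.
apply: (@abs_continuous_comp_lipschitz _ _ _ (expR M) expR) ACc _ => x y axb ayb.
wlog lexy : x y axb ayb / c * x <= c * y.
  move=> W; have [|/ltW] := leP (c * x) (c * y); first exact: W.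
  by rewrite distrC (distrC (c * y)); exact: W.
rewrite !ger0_norm ?subr_ge0 ?ler_expR//.
have eM : expR (c * y) <= expR M by rewrite ler_expR (le_trans (ler_norm _))// HM.
have e1 : 1 + (c * x - c * y) <= expR (c * x - c * y) by exact: expR_ge1Dx.
have e2 : expR (c * x) = expR (c * y) * expR (c * x - c * y).
  by rewrite -expRD; congr expR; ring.
have := expR_gt0 (c * y); nra.
Qed.

(** * Derivative rules and a Gronwall comparison *)

Lemma is_derive_expRM (R : realType) (k x : R) :
  is_derive x 1 (fun x => expR (k * x)) (k * expR (k * x)).
Proof.
have kx : is_derive x 1 (fun x => k * x) k.
  apply/is_derive1_caratheodory; exists (fun=> k); split => // [z|].
    by rewrite mulrBr.
  exact: cst_continuous.
by have := is_derive1_comp (is_derive_expR (k * x)) kx; rewrite mulrC.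
Qed.

Lemma is_derive_sum_sqr (R : realType) (n : nat) (f : 'I_n -> R -> R) (x : R)
    (d : 'I_n -> R) :
  (forall i, is_derive x 1 (f i) (d i)) ->
  is_derive x 1 (fun x => \sum_(i < n) f i x ^+ 2)
    (\sum_(i < n) 2 * f i x * d i).
Proof.
move=> fd.
have -> : (fun x => \sum_(i < n) f i x ^+ 2) = \sum_(i < n) (f i ^+ 2).
  by apply/funext => y; rewrite fct_sumE.
by apply: is_derive_sum => i; apply: is_derive_eq.
Qed.

(* The function [x |-> f x * expR (k * x)] is nonincreasing. *)
Lemma abs_continuous_gronwall (R : realType) (a b k : R) (f : R -> R) :
  a <= b -> abs_continuous a b f ->
  {ae lebesgue_measure, forall x, a <= x <= b ->
     exists2 df : R, is_derive x 1 f df & df <= - k * f x} ->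
  f a <= 0 -> f b <= 0.
Proof.
move=> ab ACf df fa0.
have : f b * expR (k * b) <= f a * expR (k * a).
  apply: (@abs_continuous_ae_nonincreasing R a b (fun x => f x * expR (k * x))) => //.
    exact: abs_continuousM (@abs_continuous_expR _ _ _ k).
  move: df; apply: lebesgue_ae_imply => x H /H[dfx dfxP dfxle].
  exists (f x * (k * expR (k * x)) + expR (k * x) * dfx).
    have ? := is_derive_expRM k x.
    by apply: is_derive_eq.
  have := expR_gt0 (k * x); nra.
have := expR_gt0 (k * a); have := expR_gt0 (k * b); nra.
Qed.

(** * Consequences of slope bounds, for the open-circuit voltage *)

Lemma le_increment_derive1 (R : realType) (V : R -> R) (k x y : R) :
  (forall s, derivable V s 1) -> (forall s, k <= derive1 V s) -> x <= y ->
  k * (y - x) <= V y - V x.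
Proof.
move=> dV kV xy.
have [z _ ->] : exists2 z, z \in `[x, y]%R & V y - V x = derive1 V z * (y - x).
  apply: MVT_segment => // [z _|]; first by rewrite derive1E; exact: derivableP.
  apply/continuous_subspaceT => z.
  exact/differentiable_continuous/derivable1_diffP.
by rewrite ler_wpM2r ?subr_ge0.
Qed.

Lemma increment_le_derive1 (R : realType) (V : R -> R) (k x y : R) :
  (forall s, derivable V s 1) -> (forall s, derive1 V s <= k) -> x <= y ->
  V y - V x <= k * (y - x).
Proof.
move=> dV Vk xy; have dN s : derivable (- V) s 1 by exact: derivableN.
have := le_increment_derive1 (k := - k) dN _ xy; rewrite !opprfctE.
suff E s : - k <= derive1 (- V) s by move=> /(_ E); lra.
by rewrite derive1E deriveN// -derive1E lerN2.
Qed.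

(** At distance [|w - V 0| / k] from 0 on either side, a slope of at least [k] has carried [V] past
    [w]; the intermediate value theorem concludes. *)
Lemma derive1_ge_surjective (R : realType) (V : R -> R) (k w : R) :
  (forall s, derivable V s 1) -> 0 < k -> (forall s, k <= derive1 V s) ->
  exists x, V x = w.
Proof.
move=> dV k0 kV; pose m := `|w - V 0| / k.
have m0 : 0 <= m by rewrite divr_ge0// ltW.
have km : k * m = `|w - V 0| by rewrite mulrC divfK// gt_eqF.
have Vm := le_increment_derive1 dV kV m0.
have VNm : k * (0 - - m) <= V 0 - V (- m).
  by apply: le_increment_derive1 => //; rewrite oppr_le0.
have := ler_norm (w - V 0); have := ler_norm (- (w - V 0)); rewrite normrN => n1 n2.
have [|||x _ <-] := @IVT R V (- m) m w.
- by rewrite (@le_trans _ _ 0)// oppr_le0.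
- apply/continuous_subspaceT => z.
  exact/differentiable_continuous/derivable1_diffP.
- by rewrite ge_min le_max; apply/andP; split; apply/orP; [left|right]; lra.
- by exists x.
Qed.

(** * Hybrid time domains *)

(* In both cases of the definition, [T j] is the starting time of the slice
   of index [j] whenever this slice is nonempty. *)
Lemma hybrid_time_domain_starts (R : realType) (E : set (R * nat)) :
  hybrid_time_domain E -> exists T : nat -> R, [/\ T 0%N = 0,
    forall j, T j <= T j.+1,
    forall t j, E (t, j) -> T j <= t /\ `[T j, t] `<=` slice E j &
    forall t j, E (t, j.+1) -> E (T j.+1, j)].
Proof.
move=> [T [T0 Tle Edef]]; exists T; case: Edef => [->|[J [I Idef ->]]].
  split=> // [t j /= /andP[jt tj]|t j _ /=]; last by rewrite Tle lexx.
  split=> // s; rewrite /slice /= in_itv/= => /andP[-> st]; exact: le_trans tj.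
split=> // t j /=.
  case=> [[jJ /andP[jt tj]]|[-> It]].
    split=> // s; rewrite /= in_itv/= => /andP[js st]; left.
    by split=> //=; rewrite js (le_trans st).
  move: It; case: Idef => [->|[S TS ->]] /=.
    rewrite in_itv/= => /andP[jt tj]; split=> // s.
    rewrite /= in_itv/= => /andP[js st]; right; split=> //=.
    by rewrite in_itv/= js (le_trans st).
  move=> [jt tS]; split=> // s; rewrite /= in_itv/= => /andP[js st]; right.
  by split=> //=; split=> //; apply: le_lt_trans tS; rewrite lee_fin.
(* A later slice exists, so slice [j] is one of the compact ones and contains its right endpoint. *)
move=> H; left; have jJ : (j < J)%N by case: H => -[/=] => [/ltnW|<-].
by split=> //=; rewrite Tle lexx.
Qed.

Lemma starts_nonneg (R : realType) (T : nat -> R) j :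
  T 0%N = 0 -> (forall j, T j <= T j.+1) -> 0 <= T j.
Proof. by move=> T0 Tle; elim: j => [|j]; rewrite ?T0// => /le_trans; exact. Qed.

(** * Estimation errors and their dissipation *)

Lemma enormE (R : realType) (n : nat) (v : 'rV[R]_n) :
  enorm v ^+ 2 = \sum_(i < n) v 0 i ^+ 2.
Proof. by rewrite sqr_sqrtr// sumr_ge0// => i _; rewrite sqr_ge0. Qed.

(** Entry [i] of [Urc s - Uhat p s], unfolded so that the scalar rules for derivatives and absolute
    continuity apply. *)
Definition urcerr (R : realType) (N : nat) (p : params R N) (s : state R N)
  (i : 'I_N) : R := Urc s 0 i - (C_d p i)^-1 * Ubar s.

Definition socerr (R : realType) (N : nat) (s : state R N) : R :=
  soc s 0 (sigma s) - soch s.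

Lemma enorm_err (R : realType) (N : nat) (p : params R N) (s : state R N) :
  enorm (err p s) ^+ 2 = socerr s ^+ 2 + \sum_(i < N) urcerr p s i ^+ 2.
Proof.
rewrite enormE big_split_ord/= big_ord1 row_mxEl mxE; congr (_ + _).
by apply: eq_bigr => i _; rewrite row_mxEr !mxE.
Qed.

Lemma ler_abs_dmax (R : realType) (N : nat) (p : params R N) i :
  `|(tau_d p)^-1 - (tau_di p i)^-1| <= dmax p.
Proof. exact: le_bigmax. Qed.

(** The input cancels, since [Urc] and the scaled [Ubar] receive it with the same gain
    [(C_d p i)^-1]; what remains is the mismatch of the time constants. *)
Lemma is_derive_urcerr (R : realType) (N : nat) (p : params R N)
    (q : R -> state R N) (u : R -> R) (t : R) i :
  flow_at p q u t -> is_derive t 1 (fun s => urcerr p (q s) i)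
    (- (tau_d p)^-1 * urcerr p (q t) i
     + ((tau_d p)^-1 - (tau_di p i)^-1) * Urc (q t) 0 i).
Proof.
move=> [/(_ i) dU _ dUbar _ _].
have d2 : is_derive t 1 (fun s => (C_d p i)^-1 * Ubar (q s))
    ((C_d p i)^-1 * (- (tau_d p)^-1 * Ubar (q t) + u t)).
  apply: is_derive_eq; rewrite /GRing.scale/=; ring.
rewrite /urcerr; apply: is_derive_eq; ring.
Qed.

(** Of the decay rate [2 / tau_d] of the squared errors, one half survives and the other absorbs the
    cross term due to the mismatch. *)
Lemma urcerr_dissipation (R : realType) (N : nat) (p : params R N)
    (s : state R N) (D : R) :
  0 < tau_d p -> dmax p * enorm (Urc s) <= D ->
  \sum_(i < N) 2 * urcerr p s i * (- (tau_d p)^-1 * urcerr p s i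
     + ((tau_d p)^-1 - (tau_di p i)^-1) * Urc s 0 i) <=
  - (tau_d p)^-1 * \sum_(i < N) urcerr p s i ^+ 2 + tau_d p * D ^+ 2.
Proof.
move=> tau0 dU; have d0 : 0 <= dmax p by exact: bigmax_ge_id.
have r1 : (tau_d p)^-1 * tau_d p = 1 by rewrite mulVf// gt_eqF.
have {dU} : dmax p ^+ 2 * \sum_(i < N) Urc s 0 i ^+ 2 <= D ^+ 2.
  rewrite -enormE -exprMn lerXn2r ?nnegrE ?mulr_ge0 ?sqrtr_ge0//.
  by apply: le_trans dU; rewrite mulr_ge0 ?sqrtr_ge0.
rewrite -(ler_pM2l tau0) mulr_sumr => dU.
rewrite (le_trans _ (lerD (lexx _) dU))// !mulr_sumr -big_split/=.
apply: ler_sum => i _.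
have := ler_abs_dmax p i.
set del := _ - _; set x := urcerr _ _ _; set y := Urc _ _ _; set r := _^-1 in r1 *.
move=> del_le; have deld : del ^+ 2 <= dmax p ^+ 2.
  by rewrite -(real_normK (num_real del)) lerXn2r// nnegrE.
(* AM-GM: [2 x del y <= x^2 / tau_d + tau_d del^2 y^2] *)
have h1 : 0 <= tau_d p * (r * x - del * y) ^+ 2 by rewrite mulr_ge0 ?sqr_ge0// ltW.
have h2 : tau_d p * (del ^+ 2 * y ^+ 2) <= tau_d p * (dmax p ^+ 2 * y ^+ 2).
  by rewrite ler_pM2l// ler_wpM2r// sqr_ge0.
have h3 : tau_d p * (r * x - del * y) ^+ 2 =
    (r * tau_d p) * r * x ^+ 2 - 2 * (r * tau_d p) * x * (del * y)
    + tau_d p * (del ^+ 2 * y ^+ 2) by ring.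
rewrite r1 in h3; lra.
Qed.

Definition sum_urcerr2 (R : realType) (N : nat) (p : params R N) (s : state R N)
  : R := \sum_(i < N) urcerr p s i ^+ 2.

Lemma sqr_urcerr_le_sum (R : realType) (N : nat) (p : params R N)
    (s : state R N) i : urcerr p s i ^+ 2 <= sum_urcerr2 p s.
Proof.
by rewrite /sum_urcerr2 (bigD1 i)//= lerDl sumr_ge0// => k _; rewrite sqr_ge0.
Qed.

(** * Error bounds along flows *)

Lemma abs_continuous_urcerr (R : realType) (N : nat) (p : params R N)
    (q : R -> state R N) (t0 t1 : R) i :
  abs_continuous t0 t1 (fun s => Urc (q s) 0 i) ->
  abs_continuous t0 t1 (fun s => Ubar (q s)) ->
  abs_continuous t0 t1 (fun s => urcerr p (q s) i).
Proof.
move=> ACU ACbar; apply: (abs_continuousB ACU).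
exact: abs_continuousM (abs_continuous_cst _ _ _) ACbar.
Qed.

(** The index, read as a real number, has derivative 0 almost everywhere, so both it and its
    opposite are nonincreasing. *)
Lemma flow_sigma (R : realType) (N : nat) (p : params R N)
    (q : R -> state R N) (u : R -> R) (t0 t1 : R) :
  t0 <= t1 -> abs_continuous t0 t1 (fun s => (sigma (q s) : nat)%:R) ->
  {ae lebesgue_measure, forall x, t0 <= x <= t1 -> flow_at p q u x} ->
  sigma (q t1) = sigma (q t0).
Proof.
move=> t01 ACs fl; apply/val_inj/eqP; rewrite -(eqr_nat R) eq_le; apply/andP; split.
  apply: (abs_continuous_ae_nonincreasing t01 ACs).
  move: fl; apply: lebesgue_ae_imply.
  by move=> x H /H[_ _ _ _ ?]; exists 0.
rewrite -lerN2.
apply: (abs_continuous_ae_nonincreasing t01 (abs_continuousN ACs)).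
move: fl; apply: lebesgue_ae_imply.
by move=> x H /H[_ _ _ _ ?]; exists 0 => //; apply: is_derive_eq; rewrite oppr0.
Qed.

(** [B] solves the comparison equation [B' = - B / tau_d + tau_d * D ^+ 2], whose equilibrium is
    [(tau_d p * D) ^+ 2]. *)
Lemma flow_sum_urcerr2 (R : realType) (N : nat) (p : params R N)
    (q : R -> state R N) (u : R -> R) (t0 t1 A D : R) :
  0 < tau_d p -> t0 <= t1 ->
  (forall i, abs_continuous t0 t1 (fun s => Urc (q s) 0 i)) ->
  abs_continuous t0 t1 (fun s => Ubar (q s)) ->
  {ae lebesgue_measure, forall x, t0 <= x <= t1 -> flow_at p q u x} ->
  {ae lebesgue_measure, forall x, t0 <= x <= t1 ->
     dmax p * enorm (Urc (q x)) <= D} ->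
  let B t := A * expR (- (tau_d p)^-1 * t) + (tau_d p * D) ^+ 2 in
  sum_urcerr2 p (q t0) <= B t0 -> sum_urcerr2 p (q t1) <= B t1.
Proof.
move=> tau0 t01 ACU ACbar fl UD B.
pose f x := sum_urcerr2 p (q x) - B x.
suff : f t0 <= 0 -> f t1 <= 0 by rewrite !subr_le0.
apply: (@abs_continuous_gronwall _ _ _ (tau_d p)^-1) => //.
  apply: abs_continuousB.
    apply: abs_continuous_sum => i.
    have ACe := abs_continuous_urcerr p (ACU i) ACbar.
    under [X in abs_continuous _ _ X]funext do rewrite expr2.
    exact: (abs_continuousM ACe ACe).
  apply: abs_continuousD; last exact: abs_continuous_cst.
  exact: abs_continuousM (abs_continuous_cst _ _ _) (@abs_continuous_expR _ _ _ _).
move: fl UD; apply: (@filterS2 _ _ (ae_filter_ringOfSetsType lebesgue_measure)).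
move=> x H1 H2 xt; have {H1} fl := H1 xt; have {H2} UD := H2 xt.
have dS := is_derive_sum_sqr (fun i => is_derive_urcerr i fl).
have dE := is_derive_expRM (- (tau_d p)^-1) x.
have dB : is_derive x 1 B (- (tau_d p)^-1 * (A * expR (- (tau_d p)^-1 * x))).
  have dA : is_derive x 1 (fun=> A) 0 by exact: is_derive_cst.
  rewrite /B; apply: is_derive_eq; rewrite /GRing.scale/=; ring.
exists (\sum_(i < N) 2 * urcerr p (q x) i * (- (tau_d p)^-1 * urcerr p (q x) i
     + ((tau_d p)^-1 - (tau_di p i)^-1) * Urc (q x) 0 i)
  - (- (tau_d p)^-1 * (A * expR (- (tau_d p)^-1 * x)))).
  by rewrite /f; apply: is_deriveB.
have := urcerr_dissipation tau0 UD; rewrite /f /B /sum_urcerr2.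
have r1 : (tau_d p)^-1 * tau_d p = 1 by rewrite mulVf// gt_eqF.
have -> : tau_d p * D ^+ 2 = (tau_d p)^-1 * (tau_d p * D) ^+ 2.
  by rewrite exprMn expr2 !mulrA r1 mul1r.
lra.
Qed.

(** The input cancels between the two charges and between the two outputs; the charge error is
    driven only by the gap of [V_ocv] and by [urcerr]. *)
Lemma flow_socerr (R : realType) (N : nat) (p : params R N)
    (q : R -> state R N) (u : R -> R) (t0 t1 M a c a1 : R) (sg : 'I_N) :
  0 < ell p -> 0 < a1 -> a <= ell p * a1 -> 0 <= M -> 0 <= c -> t0 <= t1 ->
  (forall x y, x <= y -> a1 * (y - x) <= V_ocv p y - V_ocv p x) ->
  (forall x, t0 <= x <= t1 -> sigma (q x) = sg) ->
  abs_continuous t0 t1 (fun s => soc (q s) 0 sg) ->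
  abs_continuous t0 t1 (fun s => soch (q s)) ->
  {ae lebesgue_measure, forall x, t0 <= x <= t1 -> flow_at p q u x} ->
  let B t := M * expR (- a * t) + c in
  (forall x, t0 <= x <= t1 -> urcerr p (q x) sg ^+ 2 <= a1 ^+ 2 / 4 * B x) ->
  socerr (q t0) ^+ 2 <= B t0 -> socerr (q t1) ^+ 2 <= B t1.
Proof.
move=> ell0 a10 aa M0 c0 t01 V_incr sgE ACs ACh fl B etaB.
pose f x := (soc (q x) 0 sg - soch (q x)) ^+ 2 - B x.
suff : f t0 <= 0 -> f t1 <= 0 by rewrite !subr_le0 /socerr !sgE ?lexx ?t01.
(* Completing a square leaves damping [3 / 2 * ell * a1] on the squared error and a source of
   [ell * a1 / 2] times [B]; the decrease of [B] adds at most [ell * a1] times [B], which makes both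
   rates equal. *)
apply: (@abs_continuous_gronwall _ _ _ (3 / 2 * (ell p * a1))) => //.
  apply: abs_continuousB.
    have ACe := abs_continuousB ACs ACh.
    under [X in abs_continuous _ _ X]funext do rewrite expr2.
    exact: (abs_continuousM ACe ACe).
  apply: abs_continuousD; last exact: abs_continuous_cst.
  exact: abs_continuousM (abs_continuous_cst _ _ _) (@abs_continuous_expR _ _ _ _).
move: fl; apply: lebesgue_ae_imply.
move=> x H xt; have [_ /(_ sg) dsoc _ + _] := H xt; rewrite !sgE// => dsoch.
have dE := is_derive_expRM (- a) x.
have dM : is_derive x 1 (fun=> M) 0 by exact: is_derive_cst.
pose e := soc (q x) 0 sg - soch (q x).
pose dV := V_ocv p (soc (q x) 0 sg) - V_ocv p (soch (q x)).
exists (2 * e * - (ell p * (dV - urcerr p (q x) sg)) + a * (M * expR (- a * x))).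
  rewrite /f /B; apply: is_derive_eq.
  by rewrite /GRing.scale/= /youtput /yhat /e /dV /urcerr mxE sgE//; ring.
have Bx : M * expR (- a * x) + c = B x by [].
have ME0 : 0 <= M * expR (- a * x) by rewrite mulr_ge0// expR_ge0.
have edV : a1 * e ^+ 2 <= e * dV.
  rewrite /e /dV; have [xy|/ltW xy] := leP (soch (q x)) (soc (q x) 0 sg).
    by have := V_incr _ _ xy; nra.
  by have := V_incr _ _ xy; nra.
have ee : 2 * e * urcerr p (q x) sg <= a1 / 2 * e ^+ 2 + a1 / 2 * B x.
  rewrite -(ler_pM2l a10); have := etaB x xt.
  have := sqr_ge0 (a1 * e - 2 * urcerr p (q x) sg); lra.
have aB : a * (M * expR (- a * x)) <= ell p * a1 * B x.
  apply: (@le_trans _ _ (ell p * a1 * (M * expR (- a * x)))); first by rewrite ler_wpM2r.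
  by rewrite ler_pM2l ?mulr_gt0// -Bx lerDl.
rewrite /f -/e.
have := ler_wpM2l (ltW ell0) edV; have := ler_wpM2l (ltW ell0) ee; lra.
Qed.

(** * Effect of jumps *)

Lemma zcell_urcerr (R : realType) (N : nat) (p : params R N) (s : state R N) i :
  zcell p s i = V_ocv p (soc s 0 i) - urcerr p s i.
Proof. by rewrite /zcell /urcerr mxE; ring. Qed.

(** The new index is a minimizer, so the iterated minimum is its own term; surjectivity makes
    [V_ocv_inv] a right inverse of [V_ocv]. *)
Lemma Gmap_V_soch (R : realType) (N : nat) (p : params R N)
    (s s' : state R N) :
  (forall w, exists x, V_ocv p x = w) -> Gmap p s s' ->
  V_ocv p (soch s') = zcell p s (sigma s').
Proof.
move=> Vsurj [_ _ _ -> [ns argm]].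
have -> : \big[Num.min/zcell p s (sigma s')]_(i < N | i != sigma s) zcell p s i
    = zcell p s (sigma s').
  by apply/eqP; rewrite eq_le bigmin_le_id; apply/bigmin_geP; split.
rewrite /V_ocv_inv pinvK//; have [x <-] := Vsurj (zcell p s (sigma s')).
by rewrite inE; exists x.
Qed.

Lemma ler_increasing (R : realType) (V : R -> R) (k : R) : 0 < k ->
  (forall x y, x <= y -> k * (y - x) <= V y - V x) -> {mono V : x y / x <= y}.
Proof.
move=> k0 Vk; apply: le_mono => x y xy.
have := Vk _ _ (ltW xy); have : 0 < k * (y - x) by rewrite mulr_gt0// subr_gt0.
lra.
Qed.

Lemma jump_sum_urcerr2 (R : realType) (N : nat) (p : params R N)
    (s s' : state R N) :
  Gmap p s s' -> sum_urcerr2 p s' = sum_urcerr2 p s.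
Proof.
move=> [Us' _ bs' _ _]; rewrite /sum_urcerr2.
by apply: eq_bigr => i _; rewrite /urcerr Us' bs'.
Qed.

(** After the reset, the gap of [V_ocv] between the charge of the new cell and the estimate equals
    the [urcerr] of that cell, whatever the charge error was before. *)
Lemma jump_socerr (R : realType) (N : nat) (p : params R N)
    (s s' : state R N) (a1 : R) :
  0 < a1 -> (forall x y, x <= y -> a1 * (y - x) <= V_ocv p y - V_ocv p x) ->
  (forall w, exists x, V_ocv p x = w) -> Gmap p s s' ->
  a1 ^+ 2 * socerr s' ^+ 2 <= sum_urcerr2 p s.
Proof.
move=> a10 V_incr Vsurj G; have := Gmap_V_soch Vsurj G.
case: G => [_ socE _ _ _]; rewrite zcell_urcerr -socE => VE.
apply: le_trans (sqr_urcerr_le_sum p s (sigma s')); rewrite /socerr -exprMn.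
have [xy|/ltW xy] := leP (soch s') (soc s' 0 (sigma s')).
  have := V_incr _ _ xy.
  have : 0 <= a1 * (soc s' 0 (sigma s') - soch s').
    by rewrite mulr_ge0 ?subr_ge0// ltW.
  nra.
have := V_incr _ _ xy.
have : 0 <= a1 * (soch s' - soc s' 0 (sigma s')).
  by rewrite mulr_ge0 ?subr_ge0// ltW.
nra.
Qed.

(** In [Dset] some candidate cell is below [V_ocv p (soch s)] by at least [mu_j p * eps p > 0], and
    the reset takes the minimum over the candidates. *)
Lemma jump_soch_le (R : realType) (N : nat) (p : params R N)
    (s s' : state R N) (a1 : R) :
  0 < mu_j p -> 0 < eps p ->
  0 < a1 -> (forall x y, x <= y -> a1 * (y - x) <= V_ocv p y - V_ocv p x) ->
  (forall w, exists x, V_ocv p x = w) -> Dset p s -> Gmap p s s' ->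
  soch s' <= soch s.
Proof.
move=> mu0 eps0 a10 V_incr Vsurj [_ [i isig zi]] G.
rewrite -(ler_increasing a10 V_incr) (Gmap_V_soch Vsurj G).
have [_ _ _ _ [_ /(_ i isig)]] := G.
have := mulr_gt0 mu0 eps0; lra.
Qed.

(** * The inequalities of the flow set *)

(** Cell [sigma s] is covered by [X], any other cell by its inequality in [Cset]; adding the two
    nonnegative bounds serves both cases. *)
Lemma soch_le_soc (R : realType) (N : nat) (p : params R N)
    (s : state R N) (a1 X Y : R) i :
  0 < eps p -> 0 < a1 ->
  (forall x y, x <= y -> a1 * (y - x) <= V_ocv p y - V_ocv p x) ->
  Cset p s -> `|socerr s| <= X -> (forall k, `|urcerr p s k| <= Y) ->
  soch s - soc s 0 i <= X + (Y + eps p) / a1.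
Proof.
move=> eps0 a10 V_incr Cs sX etaY.
have X0 : 0 <= X by apply: le_trans sX.
have Y0 : 0 <= Y by apply: le_trans (etaY i).
have Z0 : 0 <= (Y + eps p) / a1 by apply: divr_ge0; lra.
have [isig|isig] := eqVneq i (sigma s).
  have := ler_norm (- socerr s); rewrite normrN isig; move: sX.
  rewrite /socerr; lra.
have [xy|/ltW xy] := leP (soc s 0 i) (soch s); last by lra.
suff : soch s - soc s 0 i <= (Y + eps p) / a1 by lra.
rewrite ler_pdivlMr// mulrC.
have := V_incr _ _ xy; have := Cs i isig; rewrite zcell_urcerr.
have := le_trans (ler_norm _) (etaY i); have := ler_norm (- urcerr p s i).
have := etaY i; rewrite normrN; lra.
Qed.

Lemma abs_continuous_le_end (R : realType) (a b c : R) (g : R -> R) :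
  a < b -> abs_continuous a b g -> (forall x, a < x < b -> g x <= c) ->
  g b <= c.
Proof.
move=> ab /abs_continuous_uniform ACg gc; rewrite leNgt; apply/negP => cg.
have [|d d0 gd] := ACg (g b - c); first by rewrite subr_gt0.
pose x := Num.max ((a + b) / 2) (b - d / 2).
have ax : a < x by rewrite lt_max; apply/orP; left; lra.
have xb : x < b by rewrite gt_max; lra.
have bxd : b - x < d.
  have : b - d / 2 <= x by rewrite le_max lexx orbT.
  lra.
have := gd x b (ltW ax) (ltW xb) (lexx b) bxd.
have := ler_norm (g b - g x); have := gc x; rewrite ax xb => /(_ isT); lra.
Qed.

(** A flow is required to be in [Cset] only inside its slice; the inequalities are closed, and
    continuity with a constant [sigma] carries them to the right end. *)
Lemma slice_end_Cset (R : realType) (N : nat) (p : params R N)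
    (q : R -> state R N) (t0 t1 a2 : R) :
  t0 < t1 ->
  (forall x y, `|V_ocv p y - V_ocv p x| <= a2 * `|y - x|) ->
  (forall i, abs_continuous t0 t1 (fun s => Urc (q s) 0 i)) ->
  (forall i, abs_continuous t0 t1 (fun s => soc (q s) 0 i)) ->
  abs_continuous t0 t1 (fun s => Ubar (q s)) ->
  abs_continuous t0 t1 (fun s => soch (q s)) ->
  (forall x, t0 < x < t1 -> sigma (q x) = sigma (q t1)) ->
  (forall x, t0 < x < t1 -> Cset p (q x)) -> Cset p (q t1).
Proof.
move=> t01 Va2 ACU ACs ACb ACh sgE Cint i isig.
have ACV f : abs_continuous t0 t1 f -> abs_continuous t0 t1 (V_ocv p \o f).
  by move=> ACf; apply: (abs_continuous_comp_lipschitz (K := a2) ACf).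
pose g x := V_ocv p (soch (q x)) - (V_ocv p (soc (q x) 0 i) - urcerr p (q x) i).
have : g t1 <= eps p.
  apply: (@abs_continuous_le_end _ t0 t1) => // [|x xt].
    apply: abs_continuousB; first exact: ACV.
    apply: abs_continuousB; last exact: abs_continuous_urcerr.
    exact: (ACV (fun x => soc (q x) 0 i)).
  by have := Cint x xt i; rewrite sgE// zcell_urcerr /g => /(_ isig); lra.
by rewrite zcell_urcerr /g; lra.
Qed.

Lemma abs_continuous_subitv (R : realType) (a b a' b' : R) (f : R -> R) :
  a <= a' -> b' <= b -> abs_continuous a b f -> abs_continuous a' b' f.
Proof.
move=> aa' bb' ACf e /ACf[d d0 H]; exists d => // n l r lr; apply: H => k.
have [? [? ?]] := lr k; split; first exact: le_trans aa' _.
by split=> //; exact: le_trans bb'.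
Qed.

(** * Bounds along solutions *)

Lemma slice_flow (R : realType) (N : nat) (p : params R N) (u : R -> R)
    (E : set (R * nat)) (q : R -> nat -> state R N) (t0 t1 : R) (j : nat) :
  solution p u E q -> t0 < t1 -> `[t0, t1] `<=` slice E j ->
  [/\ {ae lebesgue_measure, forall x, t0 <= x <= t1 ->
         flow_at p (fun s => q s j) u x},
      forall x, t0 <= x <= t1 -> sigma (q x j) = sigma (q t0 j) &
      forall x, t0 < x < t1 -> Cset p (q x j)].
Proof.
move=> [[_ /(_ j)[_ _ _ _ ACsg]] _ /(_ j) sol _] t01 sub.
(* An open interval in the slice lies in its interior: this gives both the nonempty interior that
   [solution] asks for and membership in [Cset]. *)
have intE x : t0 < x < t1 -> (slice E j)° x.
  move=> xt; rewrite /interior; apply: (filterS (P := `]t0, t1[%classic)).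
    by apply: subset_trans sub; exact: subset_itv_oo_cc.
  by apply: near_in_itvoo; rewrite in_itv/=.
have [|Cint fl] := sol; first by exists ((t0 + t1) / 2); apply: intE; lra.
have fl' : {ae lebesgue_measure, forall x, t0 <= x <= t1 ->
         flow_at p (fun s => q s j) u x}.
  move: fl; apply: lebesgue_ae_imply.
  by move=> x H xt; apply/H/sub; rewrite /= in_itv.
split=> // [x /andP[t0x xt1]|x /intE /Cint//].
apply: (@flow_sigma _ _ p (fun s => q s j) u) => //.
  by apply: (abs_continuous_subitv (lexx t0) xt1); exact: ACsg (ltW t01) sub.
move: fl'; apply: lebesgue_ae_imply.
by move=> y H /andP[? ?]; apply: H; lra.
Qed.

(** The condition [a <= tau^-1] enters twice: it compares the exponentials, and it gives
    [tau ^+ 2 <= tau / a]. The result feeds the hypothesis on [urcerr] in [flow_socerr]. *)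
Lemma urcerr_bound_le (R : realType) (tau a a1 W D t : R) :
  0 < tau -> 0 < a -> a <= tau^-1 -> 0 < a1 -> 0 <= W -> 0 <= t ->
  W * expR (- tau^-1 * t) + (tau * D) ^+ 2 <=
  a1 ^+ 2 / 4 * (Num.max 1 (4 / a1 ^+ 2) * W * expR (- a * t)
                 + 4 / a1 ^+ 2 * (tau / a) * D ^+ 2).
Proof.
move=> tau0 a0 atau a10 W0 t0.
have k1 : a1 ^+ 2 / 4 * (4 / a1 ^+ 2) = 1 by field; rewrite gt_eqF.
set m := Num.max _ _; set k := 4 / _ in k1 m *.
have km : k <= m by rewrite le_max lexx orbT.
have s0 : 0 < a1 ^+ 2 / 4 by rewrite divr_gt0// exprn_gt0.
have m1 : 1 <= a1 ^+ 2 / 4 * m by have := ler_wpM2l (ltW s0) km; rewrite k1.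
have -> : a1 ^+ 2 / 4 * (m * W * expR (- a * t) + k * (tau / a) * D ^+ 2) =
    a1 ^+ 2 / 4 * m * (W * expR (- a * t)) + a1 ^+ 2 / 4 * k * (tau / a * D ^+ 2).
  by ring.
rewrite k1 mul1r; apply: lerD.
  apply: (@le_trans _ _ (W * expR (- a * t))).
    by rewrite ler_wpM2l// ler_expR !mulNr lerN2 ler_wpM2r.
  by rewrite ler_peMl// mulr_ge0// expR_ge0.
rewrite exprMn ler_wpM2r ?sqr_ge0// ler_pdivlMr// expr2 -mulrA ger_pMr//.
by rewrite mulrC -ler_pdivlMr// div1r.
Qed.

(** Induction on the number of jumps. Both envelopes depend on [t] alone, so a jump only has to
    preserve them at a fixed time. *)
Lemma solution_bounds (R : realType) (N : nat) (p : params R N) (u : R -> R)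
    (E : set (R * nat)) (q : R -> nat -> state R N) (a a1 D : R) :
  0 < tau_d p -> 0 < ell p -> 0 < a1 ->
  0 < a -> a <= ell p * a1 -> a <= (tau_d p)^-1 ->
  (forall x y, x <= y -> a1 * (y - x) <= V_ocv p y - V_ocv p x) ->
  (forall w, exists x, V_ocv p x = w) ->
  solution p u E q ->
  let W := enorm (err p (q 0 0%N)) ^+ 2 in
  forall (j : nat) (t : R), E (t, j) ->
  (forall k, (k <= j)%N -> {ae lebesgue_measure, forall s, E (s, k) -> s <= t ->
     dmax p * enorm (Urc (q s k)) <= D}) ->
  sum_urcerr2 p (q t j)
    <= W * expR (- (tau_d p)^-1 * t) + (tau_d p * D) ^+ 2 /\
  socerr (q t j) ^+ 2 <= Num.max 1 (4 / a1 ^+ 2) * W * expR (- a * t)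
    + 4 / a1 ^+ 2 * (tau_d p / a) * D ^+ 2.
Proof.
move=> tau0 ell0 a10 a0 aell atau V_incr Vsurj sol W.
have W0 : 0 <= W by exact: sqr_ge0.
have M0 : 0 <= Num.max 1 (4 / a1 ^+ 2) * W by rewrite mulr_ge0// le_max ler01.
have c0 : 0 <= 4 / a1 ^+ 2 * (tau_d p / a) * D ^+ 2.
  by rewrite mulr_ge0 ?sqr_ge0// mulr_ge0// divr_ge0 ?sqr_ge0 ?(ltW tau0) ?(ltW a0).
have [[dom arc] _ _ jump] := sol.
have [T [T0 Tle TE TJ]] := hybrid_time_domain_starts dom.
have T_ge0 j := starts_nonneg j T0 Tle.
have flow j t : E (t, j) ->
    {ae lebesgue_measure, forall s, E (s, j) -> s <= t ->
       dmax p * enorm (Urc (q s j)) <= D} ->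
    sum_urcerr2 p (q (T j) j)
      <= W * expR (- (tau_d p)^-1 * T j) + (tau_d p * D) ^+ 2 /\
    socerr (q (T j) j) ^+ 2 <= Num.max 1 (4 / a1 ^+ 2) * W * expR (- a * T j)
      + 4 / a1 ^+ 2 * (tau_d p / a) * D ^+ 2 ->
    sum_urcerr2 p (q t j)
      <= W * expR (- (tau_d p)^-1 * t) + (tau_d p * D) ^+ 2 /\
    socerr (q t j) ^+ 2 <= Num.max 1 (4 / a1 ^+ 2) * W * expR (- a * t)
      + 4 / a1 ^+ 2 * (tau_d p / a) * D ^+ 2.
  move=> Et UD [etaT socT]; have [Tt sub] := TE _ _ Et.
  move: (Tt); rewrite le_eqVlt => /orP[/eqP <-//|Ttlt].
  have [fl sg _] := slice_flow sol Ttlt sub.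
  have [ACU ACs ACb ACh _] := arc j.
  have etax x : T j <= x <= t -> sum_urcerr2 p (q x j)
      <= W * expR (- (tau_d p)^-1 * x) + (tau_d p * D) ^+ 2.
    move=> /andP[Tx xt]; have subx : `[T j, x] `<=` slice E j.
      apply: subset_trans sub => s /=; rewrite !in_itv/=; lra.
    apply: (@flow_sum_urcerr2 _ _ p (fun s => q s j) u (T j)) => //.
    - by move=> i; exact: ACU.
    - exact: ACb.
    - move: fl; apply: lebesgue_ae_imply.
      by move=> y H /andP[? ?]; apply: H; lra.
    - move: UD; apply: lebesgue_ae_imply.
      move=> y H /andP[Ty yx]; apply: H; last exact: le_trans xt.
      by apply: subx; rewrite /= in_itv/= Ty.
  split; first by apply: etax; rewrite Tt lexx.
  apply: (@flow_socerr _ _ p (fun s => q s j) u (T j) t _ _ _ a1 (sigma (q (T j) j))) => //.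
  - exact: ACs.
  - exact: ACh.
  - move=> x xt; apply: le_trans (sqr_urcerr_le_sum _ _ _) _.
    apply: le_trans (etax x xt) (urcerr_bound_le _ _ _ _ _ _ _) => //.
    by move: xt => /andP[+ _]; exact: le_trans.
elim=> [|j IHj] t Et UD; apply: flow => //; try exact: UD.
  have sW : socerr (q 0 0%N) ^+ 2 <= W.
    by rewrite /W enorm_err lerDl sumr_ge0// => i _; rewrite sqr_ge0.
  have eW : sum_urcerr2 p (q 0 0%N) <= W by rewrite /W enorm_err lerDr sqr_ge0.
  rewrite T0 !mulr0 expR0 !mulr1; split.
    by rewrite (le_trans eW)// lerDl sqr_ge0.
  rewrite (le_trans sW)// (@le_trans _ _ (Num.max 1 (4 / a1 ^+ 2) * W))// ?lerDl//.
  by rewrite ler_peMl// le_max lexx.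
have ETj := TJ _ _ Et; have [Tt sub] := TE _ _ Et.
have ETj1 : E (T j.+1, j.+1) by apply: sub; rewrite /= in_itv/= lexx.
have [|etaT socT] := IHj _ ETj.
  move=> k kj; move: (UD k (leqW kj)).
  apply: lebesgue_ae_imply.
  by move=> s H Es sT; apply: H => //; exact: le_trans Tt.
have [_ G] := jump _ _ ETj ETj1.
rewrite (jump_sum_urcerr2 G); split=> //.
(* The squared charge error after the jump is at most a quarter of its envelope [B]. *)
have := le_trans etaT (urcerr_bound_le _ tau0 a0 atau a10 W0 (T_ge0 _)).
move/(le_trans (jump_socerr a10 V_incr Vsurj G)).
set B := (X in _ -> _ <= X) => sB.
have B0 : 0 <= B by rewrite addr_ge0// mulr_ge0// expR_ge0.
have a2 : 0 < a1 ^+ 2 by rewrite exprn_gt0.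
rewrite -(ler_pM2l a2); move: sB; rewrite -/B; nra.
Qed.

(** The error bounds are assumed for every [k <= j] at time [t] because a state reached by a jump at
    [t] inherits its estimate from the state before the jump. *)
Lemma solution_soch_le_soc (R : realType) (N : nat) (p : params R N)
    (u : R -> R) (E : set (R * nat)) (q : R -> nat -> state R N)
    (a1 a2 X Y t : R) (j : nat) (i : 'I_N) :
  0 < mu_j p -> 0 < eps p -> 0 < a1 ->
  (forall x y, x <= y -> a1 * (y - x) <= V_ocv p y - V_ocv p x) ->
  (forall x y, `|V_ocv p y - V_ocv p x| <= a2 * `|y - x|) ->
  (forall w, exists x, V_ocv p x = w) ->
  solution p u E q -> E (t, j) ->
  (forall k, (k <= j)%N -> E (t, k) ->
     `|socerr (q t k)| <= X /\ forall l, `|urcerr p (q t k) l| <= Y) ->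
  soch (q t j) - soc (q t j) 0 i <= X + (Y + eps p) / a1.
Proof.
move=> mu0 eps0 a10 V_incr Va2 Vsurj sol Et XY.
have [[dom arc] init _ jump] := sol.
have [T [T0 Tle TE TJ]] := hybrid_time_domain_starts dom.
have Cset_le k : (k <= j)%N -> E (t, k) -> Cset p (q t k) ->
    soch (q t k) - soc (q t k) 0 i <= X + (Y + eps p) / a1.
  by move=> kj /(XY _ kj)[sX eY] Ck; exact: soch_le_soc eps0 a10 V_incr Ck sX eY.
have [Tt sub] := TE _ _ Et; move: (Tt); rewrite le_eqVlt => /orP[/eqP Ttj|Ttlt].
  case: j Et XY Cset_le Tt sub Ttj => [|j] Et XY Cset_le Tt sub Ttj.
    (* The initial state lies in [Cset] or [Dset], and the latter includes the inequalities of
       [Cset]. *)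
    by apply: Cset_le => //; rewrite -Ttj T0; case: init => [//|[]].
  have Etj : E (t, j) by rewrite -Ttj; exact: TJ Et.
  have [Dj G] := jump _ _ Etj Et.
  have := Cset_le j (leqnSn j) Etj Dj.1.
  have := jump_soch_le mu0 eps0 a10 V_incr Vsurj Dj G.
  by case: G => _ -> _ _ _; lra.
have [_ sg Cint] := slice_flow sol Ttlt sub.
have [ACU ACs ACb ACh _] := arc j.
apply: Cset_le => //.
apply: (@slice_end_Cset _ _ p (fun s => q s j) (T j) t a2) => //.
- by move=> k; exact: ACU.
- by move=> k; exact: ACs.
- exact: ACb.
- exact: ACh.
- by move=> x /andP[/ltW ? /ltW ?]; rewrite !sg ?lexx ?andbT//; apply/andP.
Qed.

(** * The hybrid norm as an almost everywhere bound *)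

(** One slice is enough: the essential supremum of a nonnegative function is nonnegative because the
    line has nonzero measure. *)
Lemma hnorm_ge0 (R : realType) (E : set (R * nat)) (n : nat)
    (w : R -> nat -> 'rV[R]_n) (t : R) (j : nat) : (0 <= hnorm E w t j)%E.
Proof.
have muT : lebesgue_measure [set: R] = +oo%E.
  by rewrite -set_itvNyy lebesgue_measure_itv.
rewrite /hnorm le_max; apply/orP; left.
apply: le_trans (ereal_sup_ubound (ex_intro2 _ _ 0%N I erefl)).
apply: ess_sup_ger => [|s].
  by rewrite [X in (_ < X)%E]muT ltry.
by rewrite lee_fin mulr_ge0 ?sqrtr_ge0// indicE.
Qed.

Lemma hnorm_ae (R : realType) (E : set (R * nat)) (n : nat)
    (w : R -> nat -> 'rV[R]_n) (t K : R) (j k : nat) :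
  (hnorm E w t j <= K%:E)%E -> (k <= j)%N ->
  {ae lebesgue_measure, forall s, E (s, k) -> 0 <= s <= t ->
     enorm (w s k) <= K}.
Proof.
rewrite /hnorm ge_max => /andP[H1 H2] kj.
have /ess_supP : (ess_sup lebesgue_measure (fun s : R =>
    (\1_(slice ((E `\` jump_times E) `&` upto t j) k) s * enorm (w s k))%:E)
    <= K%:E)%E.
  by apply: le_trans H1; apply: ereal_sup_ubound; exists k.
apply: lebesgue_ae_imply => s sK Es st.
(* A jump time is controlled by the plain supremum, any other time by the essential one, where the
   indicator is 1. *)
have [Es1|nEs1] := pselect (E (s, k.+1)).
  rewrite -lee_fin; apply: le_trans H2; apply: ereal_sup_ubound.
  by exists (s, k).
move: sK; rewrite lee_fin indicE mem_set ?mul1r//.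
by split; [split=> // -[]|].
Qed.

(** * The final estimate *)

(** A sharper form, with 1 in place of the square root of [N] and [1 / a1] in front of [eps p]: each
    [urcerr] is bounded on its own, not through the sum of their absolute values. *)
Lemma solution_soc_min_le (R : realType) (N : nat) (p : params R N)
    (u : R -> R) (E : set (R * nat)) (q : R -> nat -> state R N)
    (a1 a2 D t : R) (j : nat) :
  0 < mu_j p -> 0 < eps p -> 0 < tau_d p -> 0 < ell p -> 0 < a1 ->
  (forall x y, x <= y -> a1 * (y - x) <= V_ocv p y - V_ocv p x) ->
  (forall x y, `|V_ocv p y - V_ocv p x| <= a2 * `|y - x|) ->
  (forall w, exists x, V_ocv p x = w) ->
  solution p u E q -> E (t, j) -> 0 <= D ->
  let a := Num.min (ell p * a1) (1 / tau_d p) in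
  let c1 := Num.sqrt (Num.max 1 (4 / a1 ^+ 2)) in
  let c4 := 2 / a1 * Num.sqrt (tau_d p / a) in
  let b := Num.min (1 / (2 * tau_d p)) (a / 2) in
  (forall k, (k <= j)%N -> {ae lebesgue_measure, forall s, E (s, k) ->
     0 <= s <= t -> dmax p * enorm (Urc (q s k)) <= D}) ->
  `|soch (q t j) - socmin (q t j)| <=
     (1 / a1 + c1) * enorm (err p (q 0 0%N)) * expR (- b * t)
     + 1 / a1 * eps p + (tau_d p / a1 + c4) * D.
Proof.
move=> mu0 eps0 tau0 ell0 a10 V_incr Va2 Vsurj sol Et D0 a c1 c4 b UD.
have [[dom _] _ _ _] := sol.
have [T [T0 Tle TE TJ]] := hybrid_time_domain_starts dom.
have E_ge0 s k : E (s, k) -> 0 <= s.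
  by move=> /TE[+ _]; apply: le_trans; exact: starts_nonneg.
have t0 := E_ge0 _ _ Et.
have a0 : 0 < a by rewrite lt_min mulr_gt0//= divr_gt0.
have aell : a <= ell p * a1 by rewrite ge_min lexx.
have atau : a <= (tau_d p)^-1 by rewrite ge_min div1r lexx orbT.
set e0 := enorm _.
have e00 : 0 <= e0 by exact: sqrtr_ge0.
(* [X] and [Y] come from the envelopes of [solution_bounds] by taking square roots, with the root of
   a sum bounded by the sum of the roots. *)
pose X := c1 * e0 * expR (- b * t) + c4 * D.
pose Y := e0 * expR (- b * t) + tau_d p * D.
have c10 : 0 <= c1 by exact: sqrtr_ge0.
have c40 : 0 <= c4.
  by apply: mulr_ge0; rewrite ?sqrtr_ge0// divr_ge0 ?(ltW a10).
have eb0 : 0 <= e0 * expR (- b * t) by rewrite mulr_ge0 ?expR_ge0.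
have ceb0 : 0 <= c1 * e0 * expR (- b * t) by rewrite -mulrA mulr_ge0.
have cD0 : 0 <= c4 * D by exact: mulr_ge0.
have tD0 : 0 <= tau_d p * D by rewrite mulr_ge0// ltW.
have X0 : 0 <= X by exact: addr_ge0.
have Y0 : 0 <= Y by exact: addr_ge0.
(* Squaring doubles the rate of the exponential, which is why [b] is half of the smaller of [a] and
   [1 / tau_d]. *)
have expb (k : R) : 2 * b <= k -> expR (- k * t) <= expR (- b * t) ^+ 2.
  by move=> bk; rewrite -expRM_natl ler_expR; nra.
have b2a : 2 * b <= a.
  have : b <= a / 2 by rewrite ge_min lexx orbT.
  lra.
have b2tau : 2 * b <= (tau_d p)^-1.
  have : b <= 1 / (2 * tau_d p) by rewrite ge_min lexx.
  by rewrite div1r invfM; lra.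
have XY k : (k <= j)%N -> E (t, k) ->
    `|socerr (q t k)| <= X /\ forall i, `|urcerr p (q t k) i| <= Y.
  move=> kj Ek.
  have [|eB sB] := solution_bounds (D := D) tau0 ell0 a10 a0 aell atau V_incr
    Vsurj sol Ek.
    move=> l lk; move: (UD l (leq_trans lk kj)).
    apply: lebesgue_ae_imply.
    by move=> s H Es st; apply: H => //; rewrite st (E_ge0 _ _ Es).
  rewrite -/e0 in eB sB; split=> [|i].
    rewrite -(ler_pXn2r (ltn0Sn 1)) ?nnegrE// real_normK ?num_real//.
    apply: le_trans sB _.
    have c1E : c1 ^+ 2 = Num.max 1 (4 / a1 ^+ 2) by rewrite sqr_sqrtr// le_max ler01.
    have c4E : c4 ^+ 2 = 4 / a1 ^+ 2 * (tau_d p / a).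
      rewrite exprMn sqr_sqrtr ?divr_ge0 ?ltW//; congr (_ * _).
      by field; rewrite gt_eqF.
    rewrite -c1E -c4E sqrrD !exprMn.
    have := mulr_ge0 ceb0 cD0.
    have : c1 ^+ 2 * e0 ^+ 2 * expR (- a * t)
        <= c1 ^+ 2 * e0 ^+ 2 * expR (- b * t) ^+ 2.
      by rewrite ler_wpM2l ?(mulr_ge0 (sqr_ge0 _) (sqr_ge0 _))// expb.
    lra.
  rewrite -(ler_pXn2r (ltn0Sn 1)) ?nnegrE// real_normK ?num_real//.
  apply: le_trans (sqr_urcerr_le_sum _ _ _) (le_trans eB _).
  rewrite [X in _ <= X]sqrrD exprMn.
  have := mulr_ge0 eb0 tD0.
  have : e0 ^+ 2 * expR (- (tau_d p)^-1 * t) <= e0 ^+ 2 * expR (- b * t) ^+ 2.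
    by rewrite ler_wpM2l ?sqr_ge0// expb.
  lra.
have -> : (1 / a1 + c1) * e0 * expR (- b * t) + 1 / a1 * eps p
    + (tau_d p / a1 + c4) * D = X + (Y + eps p) / a1.
  by rewrite /X /Y; field; rewrite gt_eqF.
have Z0 : 0 <= (Y + eps p) / a1.
  by apply: divr_ge0; [apply: addr_ge0|]; rewrite ?(ltW eps0) ?(ltW a10).
have socmin_ge : soch (q t j) - (X + (Y + eps p) / a1) <= socmin (q t j).
  have soc_ge i : soch (q t j) - (X + (Y + eps p) / a1) <= soc (q t j) 0 i.
    rewrite lerBlDr -lerBlDl.
    exact: (solution_soch_le_soc i mu0 eps0 a10 V_incr Va2 Vsurj sol Et).
  by apply/bigmin_geP; split=> // i _; exact: soc_ge.
(* For the opposite sign, [socmin] is at most the charge of cell [sigma], so [X] alone suffices. *)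
have socmin_le : socmin (q t j) <= soc (q t j) 0 (sigma (q t j)) by exact: bigmin_le_id.
have [sX _] := XY _ (leqnn j) Et; have := le_trans (ler_norm _) sX.
by rewrite /socerr ler_norml; lra.
Qed.

Theorem theorem1 (R : realType) (N : nat) (p : params R N) (a1 a2 : R)
  (N_gt0 : (0 < N)%N)
  (Rd_gt0 : forall i, 0 < R_d p i) (Cd_gt0 : forall i, 0 < C_d p i)
  (Rint_gt0 : forall i, 0 < R_int p i) (Q_gt0 : forall i, 0 < Q_c p i)
  (V_derivable : forall s : R, derivable (V_ocv p) s 1)
  (V_C1 : continuous (derive1 (V_ocv p)))
  (a1_min : is_minimum (range (derive1 (V_ocv p))) a1)
  (a2_max : is_maximum (range (derive1 (V_ocv p))) a2)
  (a1_gt0 : 0 < a1)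
  (taud_gt0 : 0 < tau_d p) (mu_gt0 : 0 < mu_j p) (mu_le1 : mu_j p <= 1)
  (ell_gt0 : 0 < ell p) (eps_gt0 : 0 < eps p)
  (u : R -> R) (u_cadlag : cadlag u)
  (E : set (R * nat)) (q : R -> nat -> state R N)
  (q_sol : solution p u E q) :
  let a := Num.min (ell p * a1) (1 / tau_d p) in
  let c1 := Num.sqrt (Num.max 1 (4 / a1 ^+ 2)) in
  let c2 := a / 2 in
  let c3 := 4 / a1 in
  let c4 := 2 / a1 * Num.sqrt (tau_d p / a) in
  let b := Num.min (1 / (2 * tau_d p)) c2 in
  forall (t : R) (j : nat), E (t, j) ->
    ((`|soch (q t j) - socmin (q t j)|)%:E <=
     ((Num.sqrt N%:R / a1 + c1) * enorm (err p (q 0 0%N)) * expR (- b * t))%:E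
     + ((1 / a1 + c3) * eps p)%:E
     + ((Num.sqrt N%:R * tau_d p / a1 + c4) * dmax p)%:E
       * hnorm E (fun s k => Urc (q s k)) t j)%E.
Proof.
move=> a c1 c2 c3 c4 b t j Et.
have V_ge s : a1 <= derive1 (V_ocv p) s by apply: a1_min.2; exists s.
have V_le s : derive1 (V_ocv p) s <= a2 by apply: a2_max.2; exists s.
have V_incr x y : x <= y -> a1 * (y - x) <= V_ocv p y - V_ocv p x.
  exact: (le_increment_derive1 V_derivable V_ge).
have Vsurj w : exists x, V_ocv p x = w.
  exact: (derive1_ge_surjective w V_derivable a1_gt0 V_ge).
have Va2 x y : `|V_ocv p y - V_ocv p x| <= a2 * `|y - x|.
  wlog xy : x y / x <= y.
    move=> W; have [|/ltW] := leP x y; first exact: W.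
    by rewrite distrC (distrC y); exact: W.
  rewrite (ger0_norm (x := y - x)) ?subr_ge0// ger0_norm ?subr_ge0; first exact: (increment_le_derive1 V_derivable V_le xy).
  by rewrite (ler_increasing a1_gt0 V_incr).
have a0 : 0 < a by rewrite lt_min mulr_gt0//= divr_gt0.
have N1 : 1 <= Num.sqrt N%:R :> R by rewrite -[X in X <= _]sqrtr1 ler_sqrt// ler1n.
have c4_0 : 0 <= c4.
  by apply: mulr_ge0; rewrite ?sqrtr_ge0// divr_ge0 ?(ltW a1_gt0).
have k_gt0 : 0 < Num.sqrt N%:R * tau_d p / a1 + c4.
  by rewrite ltr_pwDl// divr_gt0// mulr_gt0// (lt_le_trans ltr01).
have d0 : 0 <= dmax p by exact: bigmax_ge_id.
have h0 := hnorm_ge0 E (fun s k => Urc (q s k)) t j.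
have bound D : 0 <= D ->
    (forall k, (k <= j)%N -> {ae lebesgue_measure, forall s, E (s, k) ->
      0 <= s <= t -> dmax p * enorm (Urc (q s k)) <= D}) ->
    `|soch (q t j) - socmin (q t j)| <=
      (Num.sqrt N%:R / a1 + c1) * enorm (err p (q 0 0%N)) * expR (- b * t)
      + (1 / a1 + c3) * eps p + (Num.sqrt N%:R * tau_d p / a1 + c4) * D.
  move=> D0 UD.
  apply: le_trans (solution_soc_min_le mu_gt0 eps_gt0 taud_gt0 ell_gt0 a1_gt0
    V_incr Va2 Vsurj q_sol Et D0 UD) _.
  (* The stated constants are larger, as the square root of [N] is at least 1 and [c3] is
     nonnegative. *)
  rewrite -/a -/c1 -/c4 -/c2 -/b; apply: lerD; first apply: lerD.
  - rewrite ler_wpM2r ?expR_ge0// ler_wpM2r ?sqrtr_ge0// lerD2r.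
    by rewrite ler_wpM2r// invr_ge0 ltW.
  - by rewrite ler_wpM2r ?(ltW eps_gt0)// lerDl divr_ge0 ?(ltW a1_gt0).
  - rewrite ler_wpM2r// lerD2r ler_wpM2r ?invr_ge0 ?(ltW a1_gt0)//.
    by rewrite ler_peMl// ltW.
(* With [dmax p = 0] the extended product is 0 even for an infinite norm, and [D = 0] is
   admissible. *)
have [dz|dn0] := eqVneq (dmax p) 0.
  rewrite dz mulr0 mul0e adde0 -EFinD lee_fin.
  have := bound 0 (lexx 0); rewrite mulr0 addr0; apply=> k _.
  apply: (@filterE _ _ (ae_filter_ringOfSetsType lebesgue_measure)) => s _ _.
  by rewrite dz mul0r.
have k_d : 0 < (Num.sqrt N%:R * tau_d p / a1 + c4) * dmax p.
  by rewrite mulr_gt0// lt_neqAle eq_sym dn0.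
(* An infinite norm with a positive coefficient makes the right-hand side infinite; a finite norm
   [K] gives [D = dmax p * K]. *)
case hK : (hnorm E (fun s k => Urc (q s k)) t j) h0 => [K| |//] h0; last first.
  by rewrite gt0_muley ?lte_fin// -EFinD addey// leey.
rewrite -EFinM -!EFinD lee_fin -[_ * dmax p * K]mulrA; apply: bound.
  by rewrite mulr_ge0// -lee_fin.
move=> k kj.
have hKle : (hnorm E (fun s k => Urc (q s k)) t j <= K%:E)%E by rewrite hK.
move: (hnorm_ae hKle kj).
apply: lebesgue_ae_imply => s H Es st.
by rewrite ler_wpM2l// H.
Qed.
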